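(* Let $\mathbf{F}$ be a Fraïssé structure in $L$ and let $\mathbf{F}^{*}$ be a Fraïssé precompact relational expansion of $\mathbf{F}$ in $L^{*}$. Let $G=\mathrm{Aut}(\mathbf{F})$, $G^{*}=\mathrm{Aut}(\mathbf{F}^{*})\leq G$, and let $G\curvearrowright X^{*}$ be the associated flow on $X^{*}=\widehat{G/G^{*}}$. The following are equivalent: (i) The flow $G\curvearrowright X^{*}$ is universal. (ii) The pair $(G,G^{*})$ is relatively extremely amenable.
   Context: $\mathbb{N}=\{0,1,2,\ldots\}$. $L$ is a countable first-order signature and $L^{*}=L\cup\{R_i : i\in I^{*}\}$, where $I^{*}$ is countable and each $R_i$ is a relation symbol not in $L$. A Fraïssé structure is a countable (infinite), locally finite (finitely generated substructures are finite), ultrahomogeneous structure (every isomorphism between finite substructures extends to an automorphism). $\mathrm{Age}(\mathbf{F})$ is the class of finite structures that embed in $\mathbf{F}$. An expansion $\mathbf{F}^{*}$ of $\mathbf{F}$ in $L^{*}$ is an $L^{*}$-structure $(\mathbf{F},(R^{*}_i)_{i\in I^{*}})$ whose $L$-reduct is $\mathbf{F}$; ''Fraïssé expansion'' means $\mathbf{F}^{*}$ is itself a Fraïssé structure in $L^{*}$. It is precompact if every element of $\mathrm{Age}(\mathbf{F})$ has only finitely many expansions in $\mathrm{Age}(\mathbf{F}^{*})$. Both $\mathbf{F}$ and $\mathbf{F}^{*}$ have universe $\mathbb{N}$, so $G^{*}\leq G$ are closed subgroups of $S_\infty$, the group of permutations of $\mathbb{N}$ with the topology of pointwise convergence. Let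 $d_L(g,h)=2^{-m}$ with $m=\min\{n\in\mathbb{N}: g(n)\neq h(n)\}$ (and $d_L(g,g)=0$), and let $d_R(g,h)=d_L(g^{-1},h^{-1})$, a right-invariant metric on $G$. It projects to a metric on $G/G^{*}=\{gG^{*}:g\in G\}$ (the distance between two cosets is the infimum of the distances between their elements). $X^{*}=\widehat{G/G^{*}}$ is the completion of this metric space (compact, since $\mathbf{F}^{*}$ is precompact), and $G\curvearrowright X^{*}$ is the continuous action extending left multiplication on $G/G^{*}$. All topological spaces are Hausdorff. For a topological group $G$, a $G$-flow is a continuous action of $G$ on a (nonempty) topological space $X$; it is compact if $X$ is compact, and minimal if every $x\in X$ has a dense orbit. A flow $G\curvearrowright X$ is universal if for every compact minimal $G$-flow $G\curvearrowright Y$ there is a continuous, surjective, $G$-equivariant map $\pi:X\to Y$. For topological groups $H\leq G$, the pair $(G,H)$ is relatively extremely amenable if every continuous action of $G$ on every (nonempty) compact space admits a point fixed by every element of $H$. *)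

(* Defs.v *)
From HB Require Import structures.
From mathcomp Require Import all_boot all_order all_algebra.
From mathcomp Require Import all_classical all_reals all_analysis.

Set Implicit Arguments.
Unset Strict Implicit.
Unset Printing Implicit Defensive.

Import Order.TTheory GRing.Theory Num.Theory.

Local Open Scope classical_set_scope.

Record signature := Signature {
  fsym : countType;
  far : fsym -> nat;
  rsym : countType;
  rar : rsym -> nat }.

Record structure (L : signature) (T : Type) := Structure {
  fint : forall f : fsym L, ('I_(far f) -> T) -> T;
  rint : forall r : rsym L, ('I_(rar r) -> T) -> Prop }.

Definition embedding (L : signature) (S T : Type)
    (M : structure L S) (N : structure L T) (h : S -> T) : Prop :=
  [/\ injective h,
      forall f (t : 'I_(far f) -> S), h (fint M t) = fint N (h \o t) &
      forall r (t : 'I_(rar r) -> S), rint M t <-> rint N (h \o t)].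

Definition isomorphism (L : signature) (S T : Type)
    (M : structure L S) (N : structure L T) (h : S -> T) : Prop :=
  embedding M N h /\ bijective h.

Definition automorphism (L : signature) (T : Type) (M : structure L T)
    (g : T -> T) : Prop := isomorphism M M g.

Definition subuniverse (L : signature) (T : choiceType) (M : structure L T)
    (A : set T) : Prop :=
  forall f (t : 'I_(far f) -> T), (forall i, A (t i)) -> A (fint M t).

Definition substructure (L : signature) (T : choiceType) (M : structure L T)
    (A : set T) (clA : subuniverse M A) : structure L A :=
  Structure
    (fun f (t : 'I_(far f) -> A) =>
       SigSub (mem_set (clA f (fun i => val (t i)) (fun i => set_valP (t i)))))
    (fun r (t : 'I_(rar r) -> A) => rint M (fun i => val (t i))).

Definition generated (L : signature) (T : choiceType) (M : structure L T)
    (S : set T) : set T := smallest (subuniverse M) S.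

Definition locally_finite (L : signature) (T : choiceType)
    (M : structure L T) : Prop :=
  forall S : set T, finite_set S -> finite_set (generated M S).

Definition ultrahomogeneous (L : signature) (T : choiceType)
    (M : structure L T) : Prop :=
  forall (A B : set T) (clA : subuniverse M A) (clB : subuniverse M B),
    finite_set A -> finite_set B ->
    forall h : A -> B, isomorphism (substructure clA) (substructure clB) h ->
    exists2 g : T -> T, automorphism M g & forall x : A, g (val x) = val (h x).

(* Countability and infiniteness are enforced by the universe being nat. *)
Definition Fraisse (L : signature) (M : structure L nat) : Prop :=
  locally_finite M /\ ultrahomogeneous M.

Definition age (L : signature) (T : Type) (M : structure L T)
    (A : finType) (N : structure L A) : Prop := exists h, embedding N M h.

Definition expand_sig (L : signature) (I : countType) (ar : I -> nat) :
    signature :=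
  @Signature (fsym L) (@far L) (rsym L + I)%type
    (fun s => match s with inl r => rar r | inr i => ar i end).

(* Interpretations on T of the new symbols R_i (i : I), R_i having arity ar i. *)
Definition relations (I : countType) (ar : I -> nat) (T : Type) : Type :=
  forall i : I, ('I_(ar i) -> T) -> Prop.

Definition expansion (L : signature) (I : countType) (ar : I -> nat) (T : Type)
    (M : structure L T) (Rs : relations ar T) : structure (expand_sig L ar) T :=
  @Structure (expand_sig L ar) T (@fint L T M)
    (fun s => match s with inl r => @rint L T M r | inr i => Rs i end).

(* The expansions of N are counted as structures on the fixed universe A, not up
   to isomorphism; for finite A and each N this finiteness does not depend on the
   choice. *)
Definition precompact_expansion (L : signature) (I : countType) (ar : I -> nat)
    (T : Type) (M : structure L T) (Rs : relations ar T) : Prop :=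
  forall (A : finType) (N : structure L A), age M N ->
    finite_set [set S : relations ar A | age (expansion M Rs) (expansion N S)].

HB.mixin Record isTopologicalGroup G of Topological G & Group G := {
  mulg_continuous : continuous (fun p : G * G => (p.1 * p.2)%g);
  invg_continuous : continuous (fun g : G => (g^-1)%g) }.

#[short(type="topologicalGroupType")]
HB.structure Definition TopologicalGroup :=
  {G of Topological G & Group G & isTopologicalGroup G}.

(* All topological spaces carrying a flow are nonempty and Hausdorff. *)
Record is_flow (G : topologicalGroupType) (X : topologicalType)
    (act : G -> X -> X) : Prop := IsFlow {
  flow_nonempty : [set: X] !=set0;
  flow_hausdorff : hausdorff_space X;
  flow1 : forall x, act 1%g x = x;
  flowM : forall g h x, act (g * h)%g x = act g (act h x);
  flow_continuous : continuous (fun p : G * X => act p.1 p.2) }.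

Definition minimal_flow (G : topologicalGroupType) (X : topologicalType)
    (act : G -> X -> X) : Prop := forall x, dense [set act g x | g in setT].

Definition universal_flow (G : topologicalGroupType) (X : topologicalType)
    (actX : G -> X -> X) : Prop :=
  forall (Y : topologicalType) (actY : G -> Y -> Y),
    is_flow actY -> compact [set: Y] -> minimal_flow actY ->
    exists p : X -> Y,
      [/\ continuous p, forall y, exists x, p x = y &
          forall g x, p (actX g x) = actY g (p x)].

Definition relatively_extremely_amenable (G : topologicalGroupType)
    (H : set G) : Prop :=
  forall (X : topologicalType) (act : G -> X -> X),
    is_flow act -> compact [set: X] ->
    exists x, forall h, H h -> act h x = x.

(* The inverse is stored as data, but is determined by sfun (sym_ext), and the
   topology below only involves sfun. *)
Record sym := Sym {
  sfun : nat -> nat;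
  sinv : nat -> nat;
  sfunK : cancel sfun sinv;
  sinvK : cancel sinv sfun }.

Coercion sfun : sym >-> Funclass.

Lemma sym_ext (g h : sym) : sfun g = sfun h -> g = h.
Proof.
case: g h => f f' fK fK' [k k' kK kK'] /= fk; subst k.
have e : f' = k' by apply/funext => n; rewrite -{1}(kK' n) fK.
by subst k'; rewrite (Prop_irrelevance fK kK) (Prop_irrelevance fK' kK').
Qed.

HB.instance Definition _ := gen_eqMixin sym.
HB.instance Definition _ := gen_choiceMixin sym.

Definition sym1 : sym := @Sym id id (fun=> erefl) (fun=> erefl).
Definition symV (g : sym) : sym := Sym (@sinvK g) (@sfunK g).
Definition symM (g h : sym) : sym :=
  Sym (can_comp (@sfunK g) (@sfunK h)) (can_comp (@sinvK h) (@sinvK g)).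

Lemma symMA : associative symM. Proof. by move=> *; apply: sym_ext. Qed.
Lemma sym1M : left_id sym1 symM. Proof. by move=> *; apply: sym_ext. Qed.
Lemma symM1 : right_id sym1 symM. Proof. by move=> *; apply: sym_ext. Qed.
Lemma symVM : left_inverse sym1 symV symM.
Proof. by move=> g; apply: sym_ext; apply/funext => n /=; rewrite sfunK. Qed.
Lemma symMV : right_inverse sym1 symV symM.
Proof. by move=> g; apply: sym_ext; apply/funext => n /=; rewrite sinvK. Qed.

HB.instance Definition _ := isGroup.Build sym symMA sym1M symM1 symVM symMV.
HB.instance Definition _ := Topological.copy sym
  (initial_topology (sfun : sym -> {ptws nat -> nat})).

Lemma sym_cvgP (F : set_system sym) (g : sym) : Filter F ->
  F --> g <-> forall n, F [set h : sym | h n = g n].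
Proof.
move=> FF; split=> [Fg n|Fg].
  have gc : (fun h : sym => h n) @ g --> g n.
    have c1 : (sfun : sym -> {ptws nat -> nat}) @ g --> (sfun g : {ptws nat -> nat}).
      exact: initial_continuous.
    exact: cvg_trans (cvg_app _ c1)
      (@proj_continuous _ (fun _ : nat => nat : topologicalType) n (sfun g)).
  have := cvg_trans (cvg_app _ Fg) gc.
  by move=> /(_ [set g n]); apply; apply/discrete_set1.
move=> U [_ [[V oV <-] Vg VU]]; apply: (filterS VU).
have FF' : Filter (sfun @ F) by exact: fmap_filter.
have : {ptws, sfun @ F --> sfun g}.
  apply/pointwise_cvgP => n W /nbhs_singleton Wg.
  have : F [set h : sym | W (h n)] by apply: filterS (Fg n) => h /= ->.
  exact.
by move=> /(_ V); apply; apply: open_nbhs_nbhs.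
Qed.

Lemma sym_mul_continuous : continuous (fun p : sym * sym => (p.1 * p.2)%g).
Proof.
move=> [g h]; apply/sym_cvgP => n.
exists ([set k : sym | k (h n) = g (h n)], [set k : sym | k n = h n]) => /=.
  by split; apply: (iffLR (sym_cvgP _ _)); exact: cvg_id.
by case=> k l /= [kg lh]; rewrite -kg -lh.
Qed.

Lemma sym_inv_continuous : continuous (fun g : sym => (g^-1)%g).
Proof.
move=> g; have FF : Filter ((fun h : sym => h^-1)%g @ nbhs g).
  exact: (fmap_filter _ (nbhs_filter g)).
apply: (iffRL (sym_cvgP _ FF)) => n.
have : nbhs g [set k : sym | k (sinv g n) = g (sinv g n)].
  by apply: (iffLR (sym_cvgP _ _)); exact: cvg_id.
apply: filterS => k kg; rewrite /= -[in LHS](sinvK g n) -kg.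
exact: sfunK.
Qed.

HB.instance Definition _ := isTopologicalGroup.Build sym
  sym_mul_continuous sym_inv_continuous.

Lemma comp_embedding (L : signature) (S T U : Type) (M : structure L S)
    (N : structure L T) (P : structure L U) (h : S -> T) (k : T -> U) :
  embedding M N h -> embedding N P k -> embedding M P (k \o h).
Proof.
move=> [hi hf hr] [ki kf kr]; split; first exact: inj_comp.
  by move=> f t; rewrite /= hf kf.
by move=> r t; rewrite hr kr.
Qed.

Lemma can_embedding (L : signature) (S T : Type) (M : structure L S)
    (N : structure L T) (h : S -> T) (k : T -> S) :
  cancel h k -> cancel k h -> embedding M N h -> embedding N M k.
Proof.
move=> hk kh [_ hf hr]; split; first exact: can_inj kh.
  move=> f t; apply: (can_inj hk); rewrite kh hf; congr fint.
  by apply/funext => i /=; rewrite kh.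
move=> r t; rewrite hr (_ : h \o (k \o t) = t) //.
by apply/funext => i /=; rewrite kh.
Qed.

Lemma sym_automorphism (L : signature) (M : structure L nat) (g : sym) :
  automorphism M g <-> embedding M M g.
Proof. by split=> [[]|gM] //; split=> //; exists (sinv g); case: g {gM}. Qed.

Definition autset (L : signature) (M : structure L nat) : set sym :=
  [set g : sym | automorphism M g].

Lemma autset_group_closed (L : signature) (M : structure L nat) :
  group_closed (mem (autset M)).
Proof.
split; first by rewrite inE; apply/sym_automorphism; split.
move=> g h; rewrite !inE => /sym_automorphism gM /sym_automorphism hM.
apply/sym_automorphism; apply: (comp_embedding _ gM).
exact: can_embedding (@sfunK h) (@sinvK h) hM.
Qed.

Definition Aut (L : signature) (M : structure L nat) : Type :=
  set_type (autset M).

HB.instance Definition _ (L : signature) (M : structure L nat) :=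
  SubChoice.on (Aut M).
HB.instance Definition _ (L : signature) (M : structure L nat) :=
  Topological.on (Aut M).
HB.instance Definition _ (L : signature) (M : structure L nat) :=
  SubChoice_isSubGroup.Build sym _ (Aut M) (autset_group_closed M).

Lemma Aut_mul_continuous (L : signature) (M : structure L nat) :
  continuous (fun p : Aut M * Aut M => (p.1 * p.2)%g).
Proof.
apply: continuous_comp_initial => -[g h].
have vc : continuous (set_val : Aut M -> sym) by exact: initial_continuous.
apply: (@cvg_trans _ ((fun p : sym * sym => (p.1 * p.2)%g) @
  ((fun p : Aut M * Aut M => (set_val p.1, set_val p.2)) @ nbhs (g, h)))) => //.
have e : (set_val \o (fun p : Aut M * Aut M => (p.1 * p.2)%g)) (g, h) =
    (set_val g * set_val h)%g :> sym by [].
rewrite e; apply: cvg_trans; last exact: (@sym_mul_continuous (set_val g, set_val h)).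
apply: cvg_app.
apply: (@cvg_pair _ _ _ _ (nbhs (set_val g)) (nbhs (set_val h))) => /=.
  exact: cvg_trans (cvg_app _ cvg_fst) (vc g).
exact: cvg_trans (cvg_app _ cvg_snd) (vc h).
Qed.

Lemma Aut_inv_continuous (L : signature) (M : structure L nat) :
  continuous (fun g : Aut M => (g^-1)%g).
Proof.
apply: continuous_comp_initial => g.
have vc : continuous (set_val : Aut M -> sym) by exact: initial_continuous.
have e : set_val \o (fun g : Aut M => g^-1)%g =
    (fun g : sym => g^-1)%g \o set_val by [].
rewrite e; exact: cvg_trans (cvg_app _ (vc g)) (@sym_inv_continuous (set_val g)).
Qed.

HB.instance Definition _ (L : signature) (M : structure L nat) :=
  isTopologicalGroup.Build (Aut M)
    (@Aut_mul_continuous L M) (@Aut_inv_continuous L M).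

(* The elements of Aut M that are automorphisms of N; for an expansion N of M
   this is the whole of the automorphism group of N. *)
Definition Aut_sub (L L' : signature) (M : structure L nat)
    (N : structure L' nat) : set (Aut M) :=
  [set g : Aut M | automorphism N (val g)].

Arguments Aut_sub {L L'} M N _.

Lemma Aut_sub_group_closed (L L' : signature) (M : structure L nat)
    (N : structure L' nat) : group_closed (mem (Aut_sub M N)).
Proof.
have [N1 Nd] := autset_group_closed N.
split; first by move: N1; rewrite !inE.
move=> g h; rewrite !inE => gN hN.
by have := Nd (val g) (val h); rewrite !inE; apply.
Qed.

Lemma Aut_sub_expansion (L : signature) (I : countType) (ar : I -> nat)
    (M : structure L nat) (Rs : relations ar nat) :
  [set val g | g in Aut_sub M (expansion M Rs)] = autset (expansion M Rs).
Proof.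
apply/seteqP; split=> [_ [g gR <-] //|g gR].
have gM : autset M g.
  case: gR => -[gi gf gr] gb; split=> //; split=> //.
  by move=> r t; exact: (gr (inl r) t).
by exists (SigSub (mem_set gM)).
Qed.

Definition lcoset_set (G : groupType) (H : set G) (g : G) : set G :=
  [set (g * h)%g | h in H].

Definition lcoset_space (G : groupType) (H : set G) : set (set G) :=
  range (lcoset_set H).

Definition lcoset_of (G : groupType) (H : set G) (g : G) : lcoset_space H :=
  SigSub (mem_set (imageT (lcoset_set H) g)).

Local Open Scope ring_scope.

Definition dL (R : realType) (g h : sym) : R :=
  match pselect (exists n, g n != h n) with
  | left ex => 2 ^- ex_minn ex
  | right _ => 0
  end.

Definition dR (R : realType) (g h : sym) : R := dL R (g^-1)%g (h^-1)%g.

Definition coset_dist (R : realType) (L : signature) (M : structure L nat)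
    (H : set (Aut M)) (C D : lcoset_space H) : R :=
  inf [set dR R (val g) (val h) | g in val C & h in val D].

(* X, with the map j, is a completion of the set Q endowed with the metric d;
   such an X is unique up to a unique isometry compatible with the maps j. *)
Definition is_completion (R : realType) (Q : Type) (d : Q -> Q -> R)
    (X : metricType R) (j : Q -> X) : Prop :=
  [/\ forall F : set_system X, ProperFilter F -> cauchy F ->
        exists x : X, F --> x,
      forall p q, mdist (j p) (j q) = d p q &
      dense (range j)].

(* act is the continuous action of G = Aut M on the completion X of G / H that
   extends left multiplication; it is unique since j has dense range. *)
Definition is_completion_flow (R : realType) (L : signature)
    (M : structure L nat) (H : set (Aut M)) (X : metricType R)
    (j : lcoset_space H -> X) (act : Aut M -> X -> X) : Prop :=
  [/\ is_completion (@coset_dist R L M H) j,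
      is_flow act &
      forall g x : Aut M,
        act g (j (lcoset_of H x)) = j (lcoset_of H (g * x)%g)].

(* Main.v *)
Require Import Defs.
From mathcomp Require Import all_boot all_order all_algebra.
From mathcomp Require Import finmap.
From mathcomp Require Import all_classical all_reals all_analysis.
From mathcomp Require Import lra.

Set Implicit Arguments.
Unset Strict Implicit.
Unset Printing Implicit Defensive.

Import Order.TTheory GRing.Theory Num.Theory.
Local Open Scope classical_set_scope.
Local Open Scope ring_scope.

(** Write F* for the expansion and H for its automorphism group, a subgroup of
    G = Aut F; the coset space G/H is dense in the completion X, and the
    base point of X is the image of the coset H.

    Universality implies that (G, H) is relatively extremely amenable: every
    compact flow contains a minimal subflow ([exists_minimal_subflow]), which
    by universality is an equivariant image of X. The base point of X is fixed
    by H, hence so is its image.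

    Conversely, let Y be a compact minimal flow and y0 a point of Y fixed by H.
    The orbit map sending gH to g y0 extends to a continuous equivariant map on
    X ([orbit_map_extension]). Instead of a uniform structure on Y, the proof
    uses the closure in X x Y of the graph of the orbit map, and shows that it
    is the graph of a continuous function: if gH and hH are close, then h y0 =
    k (g y0) for some k close to 1 ([completion_unif]), and k moves no point of
    a neighbourhood of z1 to a neighbourhood of a distinct point z2. The range
    of the extension contains the dense orbit of y0, and it is closed because X
    is compact ([completion_compact]).

    Compactness of X is where the hypotheses on F and F* enter. For each m,
    let B be the finite substructure of F generated by 0, ..., m-1.
    If two automorphisms g and d of F pull back the new relations of F* to the
    same relations on B, then g(B) and d(B) are isomorphic substructures of F*
    through d g^-1, so by ultrahomogeneity of F* some c in H satisfies c g = d
    on B ([same_relations_translate]). Precompactness leaves only finitely many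
    pullbacks on B, so G/H is totally bounded. *)

(** * Minimal subflows *)

Lemma flow_act_continuous (G : topologicalGroupType) (X : topologicalType)
    (act : G -> X -> X) (g : G) : is_flow act -> continuous (act g).
Proof.
move=> actF x; apply: cvg_trans (@flow_continuous _ _ _ actF (g, x)).
apply: (cvg_app (fun p : G * X => act p.1 p.2)
  (F := (fun y => (g, y)) @ nbhs x)).
by apply: cvg_pair; [exact: cvg_cst|exact: cvg_id].
Qed.

(** The complement of U is a minimal nonempty closed invariant set. The union of
    a chain of proper open invariant sets is proper by compactness, so that
    Zorn's lemma applies. *)
Lemma maximal_open_invariant (G : topologicalGroupType) (X : topologicalType)
    (act : G -> X -> X) : is_flow act -> compact [set: X] ->
  let P := [set U : set X | [/\ open U, forall g x, U x -> U (act g x) &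
                                 exists x, ~ U x]] in
  exists U, P U /\ forall V, U `<` V -> ~ P V.
Proof.
move=> actF Xco P; apply: Zorn_bigcup => C CP Ctot; split.
- by apply: bigcup_open => U /CP[].
- move=> g x [U CU Ux]; exists U => //; have [_ Uinv _] := CP _ CU.
  exact: Uinv.
have [[U0 CU0]|C0] := pselect (C !=set0); last first.
  have [x _] := flow_nonempty actF; exists x => -[U CU _].
  by apply: C0; exists U.
(* If the chain C covered X, a cluster point of the filter generated by the
   complements of its members would lie in some member of C, which is open, and in
   the closure of its complement. *)
pose B := filter_from C (fun U => ~` U).
have BF : ProperFilter B.
  apply: filter_from_proper; last by move=> U /CP[_ _ [x nUx]]; exists x.
  apply: filter_from_filter; first by exists U0.
  move=> U V CU CV; have [UV|VU] := Ctot _ _ CU CV.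
    by exists V => // x nVx; split=> // /UV.
  by exists U => // x nUx; split=> // /VU.
have [x [_ xcl]] := Xco B BF filterT.
exists x => -[U CU Ux]; have [Uo _ _] := CP _ CU.
have BU : B (~` U) by exists U.
by have [z [nUz Uz]] := xcl _ _ BU (open_nbhs_nbhs (conj Uo Ux)).
Qed.

Lemma compact_set_type (X : topologicalType) (A : set X) :
  compact A -> compact [set: A].
Proof.
move=> Aco F FF _.
have vF : ProperFilter ((set_val : A -> X) @ F) by exact: fmap_proper_filter.
have vA : F [set a : A | A (set_val a)].
  by apply: filterS (@filterT _ F _) => a _; exact: (set_valP a).
have [x [Ax xcl]] := Aco _ vF vA.
exists (SigSub (mem_set Ax)); split=> // B C FB [_ [[V Vo <-] Vx VC]].
have FvB : F [set a : A | ((set_val : A -> X) @` B) (set_val a)].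
  by apply: filterS FB => b Bb; exists b.
have [z [[b Bb <-] Vz]] := xcl _ _ FvB (open_nbhs_nbhs (conj Vo Vx)).
by exists b; split=> //; exact: VC.
Qed.

Lemma hausdorff_set_type (X : topologicalType) (A : set X) :
  hausdorff_space X -> hausdorff_space A.
Proof.
move=> Xh a b ab; apply: val_inj; apply: Xh => U V Ua Vb.
have vc : continuous (set_val : A -> X) by exact: initial_continuous.
by have [c [Uc Vc]] := ab _ _ (vc a U Ua) (vc b V Vb); exists (set_val c).
Qed.

Section subflow.
Variables (G : topologicalGroupType) (X : topologicalType) (act : G -> X -> X).
Variables (A : set X) (Ainv : forall g x, A x -> A (act g x)).

(** The action induced on an invariant subset A. *)
Definition subflow (g : G) (a : A) : A :=
  SigSub (mem_set (Ainv g (set_valP a))).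

Lemma is_flow_subflow : is_flow act -> A !=set0 -> is_flow subflow.
Proof.
move=> actF [x Ax]; split.
- by exists (SigSub (mem_set Ax)).
- exact/hausdorff_set_type/flow_hausdorff/actF.
- by move=> a; apply: val_inj; exact: flow1 actF _.
- by move=> g h a; apply: val_inj; exact: flowM actF _ _ _.
apply: continuous_comp_initial => -[g a].
have vc : continuous (set_val : A -> X) by exact: initial_continuous.
apply: (cvg_trans _ (@flow_continuous _ _ _ actF (g, set_val a))).
apply: (cvg_app (fun p : G * X => act p.1 p.2)
  (F := (fun p : G * A => (p.1, set_val p.2)) @ nbhs (g, a))).
apply: (@cvg_pair _ _ _ _ (nbhs g) (nbhs (set_val a))) => /=.
  exact: cvg_fst.
exact: cvg_trans (cvg_app _ cvg_snd) (vc a).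
Qed.

End subflow.

Lemma exists_minimal_subflow (G : topologicalGroupType) (X : topologicalType)
    (act : G -> X -> X) : is_flow act -> compact [set: X] ->
  exists (A : set X) (Ainv : forall g x, A x -> A (act g x)),
    [/\ A !=set0, compact A & minimal_flow (subflow Ainv)].
Proof.
move=> actF Xco; have [U [[Uo Uinv [x0 nUx0]] Umax]] :=
  maximal_open_invariant actF Xco.
have Ainv g x : (~` U) x -> (~` U) (act g x).
  move=> nUx Ugx; apply: nUx; have := Uinv g^-1%g _ Ugx.
  by rewrite -(flowM actF) mulVg (flow1 actF).
exists (~` U), Ainv; split; first by exists x0.
  by apply: (subclosed_compact _ Xco) => //; exact: open_closedC.
move=> a O [b Ob] [W Wo WO]; subst O.
apply: contrapT => noorb.
(* The translates of W, together with U, form an open invariant set that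
   strictly contains U and misses the orbit of a. *)
pose V := U `|` \bigcup_g (act g @^-1` W).
apply: (Umax V); last split.
- split; first by move=> x Ux; left.
  move=> VU; have /VU Ub : V (set_val b).
    by right; exists 1%g => //=; rewrite (flow1 actF).
  exact: (set_valP b Ub).
- apply: openU => //; apply: bigcup_open => g _.
  by apply: open_comp => // x _; exact: flow_act_continuous.
- move=> g x [Ux|[h _ /= Whx]]; first by left; exact: Uinv.
  by right; exists (h * g^-1)%g => //=; rewrite -(flowM actF) mulgVK.
exists (set_val a) => -[/(set_valP a)//|[g _ /= Wga]].
by apply: noorb; exists (subflow Ainv g a); split=> //; exists g.
Qed.

(** * Extension of an orbit map *)

Section extension.
Variables (R : realType) (G : topologicalGroupType) (X : pseudoMetricType R).
Variables (phi : G -> X) (Y : topologicalType) (actY : G -> Y -> Y) (y0 : Y).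
Hypotheses (phi_dense : dense (range phi)) (actYF : is_flow actY).
Hypothesis Yco : compact [set: Y].
(* The orbit map of y0 factors uniformly through phi, for the right uniformity
   of G: if phi g and phi h are close, then h moves y0 to a translate of g y0 by
   an element close to 1. *)
Hypothesis orbit_unif : forall V : set G, nbhs 1%g V ->
  exists2 e : R, 0 < e & forall g h, ball (phi g) e (phi h) ->
    exists2 k, V k & actY h y0 = actY k (actY g y0).

(** The closure in X * Y of the set of pairs (phi g, g y0). *)
Definition orbit_closure_rel (x : X) (z : Y) : Prop :=
  forall U W, nbhs x U -> nbhs z W -> exists g, U (phi g) /\ W (actY g y0).

Lemma orbit_closure_rel_total x : exists z, orbit_closure_rel x z.
Proof.
pose F : set_system Y :=
  filter_from (nbhs x) (fun U => [set actY g y0 | g in phi @^-1` U]).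
have FF : ProperFilter F.
  apply: filter_from_proper.
    apply: filter_from_filter; first by exists setT; exact: filterT.
    move=> U V xU xV; exists (U `&` V); first exact: filterI.
    by move=> _ [g [Ug Vg] <-]; split; exists g.
  move=> U /nbhs_interior xU.
  have [x' [Ug [g _ gE]]] := phi_dense (ex_intro _ x (nbhs_singleton xU))
    (@open_interior _ U).
  by exists (actY g y0), g => //; rewrite /= gE; exact: interior_subset.
have [z [_ zcl]] := Yco FF filterT.
exists z => U W xU zW.
have FU : F [set actY g y0 | g in phi @^-1` U] by exists U.
by have [_ [[g Ug <-] Wg]] := zcl _ _ FU zW; exists g.
Qed.

(** This gives both the uniqueness of the point related to a given x (take
    x1 = x2) and the continuity of the resulting function. *)
Lemma orbit_closure_rel_separated (z1 z2 : Y) : z1 <> z2 ->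
  exists (e : R) (W1 W2 : set Y),
    [/\ 0 < e, nbhs z1 W1, nbhs z2 W2 &
    forall x1 x2 w1 w2, orbit_closure_rel x1 w1 -> orbit_closure_rel x2 w2 ->
      W1 w1 -> W2 w2 -> ~ ball x1 e x2].
Proof.
move=> z12; have := flow_hausdorff actYF.
rewrite open_hausdorff => /(_ z1 z2 (introN eqP z12)) [[U1 U2] /=].
rewrite !inE => -[U1z U2z] [U1o U2o /disjoints_subset U12].
(* By continuity of the action at (1, z1), elements of V map W into U1, which is
   disjoint from the neighbourhood U2 of z2. *)
have := @flow_continuous _ _ _ actYF (1%g, z1) U1.
rewrite /= (flow1 actYF) => /(_ (open_nbhs_nbhs (conj U1o U1z))).
move=> [[V W] /= [V1 Wz] VW].
have [e e0 He] := orbit_unif V1.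
exists (e / 3), W°, U2; split.
- by rewrite divr_gt0.
- exact: nbhs_interior.
- exact: open_nbhs_nbhs.
move=> x1 x2 w1 w2 r1 r2 Ww1 Uw2 x12.
have e3 : 0 < e / 3 by rewrite divr_gt0.
have [g [xg Wg]] := r1 _ _ (nbhsx_ballx x1 _ e3) Ww1.
have [h [xh Uh]] := r2 _ _ (nbhsx_ballx x2 _ e3)
  (open_nbhs_nbhs (conj U2o Uw2)).
have eE : e = e / 3 + e / 3 + e / 3 by lra.
have gh : ball (phi g) e (phi h).
  rewrite eE; apply: ball_triangle xh; apply: ball_triangle x12.
  exact: ball_sym.
have [k Vk hE] := He _ _ gh.
by apply: (U12 (actY h y0)) Uh; rewrite hE; exact: (VW (k, _)).
Qed.

Lemma orbit_closure_rel_unique x z1 z2 :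
  orbit_closure_rel x z1 -> orbit_closure_rel x z2 -> z1 = z2.
Proof.
move=> r1 r2; apply: contrapT => /orbit_closure_rel_separated.
move=> [e [W1 [W2 [e0 zW1 zW2 H]]]].
apply: (H _ _ _ _ r1 r2);
  [exact: nbhs_singleton zW1|exact: nbhs_singleton zW2|].
exact: ballxx.
Qed.

Lemma orbit_closure_rel_orbit g : orbit_closure_rel (phi g) (actY g y0).
Proof. by move=> U W /nbhs_singleton Ug /nbhs_singleton Wg; exists g. Qed.

Lemma orbit_map_extension (actX : G -> X -> X) :
  (forall g, continuous (actX g)) ->
  (forall g h, actX g (phi h) = phi (g * h)%g) ->
  exists p : X -> Y, [/\ continuous p, forall g, p (phi g) = actY g y0 &
    forall g x, p (actX g x) = actY g (p x)].
Proof.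
move=> actXc actXphi.
have [p pP] := choice orbit_closure_rel_total.
exists p; split.
- move=> x.
  have pF : ProperFilter (p @ nbhs x) by exact: fmap_proper_filter.
  apply: (compact_cluster_set1 (flow_hausdorff actYF) Yco) => //;
    try exact: filterT.
  (* Y being compact, it suffices that p x is the only cluster point of p
     at x. *)
  have zclE z : cluster (p @ nbhs x) z -> z = p x.
    move=> zcl; apply: contrapT => /orbit_closure_rel_separated.
    move=> [e [W1 [W2 [e0 zW1 zW2 H]]]].
    have pB : nbhs x [set x' | (p @` ball x e) (p x')].
      by apply: filterS (nbhsx_ballx x e e0) => x' xx'; exists x'.
    have [_ [[x' xx' <-] W1x']] := zcl _ _ pB zW1.
    apply: (H _ _ _ _ (pP x') (pP x) W1x' (nbhs_singleton zW2)).
    exact: ball_sym.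
  apply/seteqP; split => [z /zclE//|_ ->].
  by have [z [_ /[dup] /zclE ->]] := Yco pF filterT.
- move=> g.
  exact: (orbit_closure_rel_unique (pP _) (@orbit_closure_rel_orbit g)).
move=> g x; apply: (orbit_closure_rel_unique (pP _)) => U W gxU gzW.
have [h [Uh Wh]] := pP x _ _ (actXc g x U gxU)
  (flow_act_continuous actYF gzW).
by exists (g * h)%g; rewrite -actXphi (flowM actYF).
Qed.

End extension.

(** * The metrics on the symmetric group and on coset spaces *)

Lemma dL_lt (R : realType) (g h : sym) (m n : nat) :
  dL R g h < 2 ^- m -> (n <= m)%N -> g n = h n.
Proof.
rewrite /dL; case: pselect => [ex|nex] gh nm; last first.
  by apply: contrapT => /eqP gnh; apply: nex; exists n.
apply/eqP; apply: contraLR gh => gnh; rewrite -leNgt.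
case: ex_minnP => k _ /(_ n gnh) kn.
by rewrite lef_pV2 ?posrE ?exprn_gt0// ler_weXn2l ?ler1n// (leq_trans kn).
Qed.

Lemma dL_le (R : realType) (g h : sym) (m : nat) :
  (forall n, (n < m)%N -> g n = h n) -> dL R g h <= 2 ^- m.
Proof.
rewrite /dL => gh; case: pselect => [ex|nex]; last first.
  by rewrite invr_ge0 exprn_ge0.
case: ex_minnP => k gkh _.
rewrite lef_pV2 ?posrE ?exprn_gt0// ler_weXn2l ?ler1n// leqNgt.
by apply: contra gkh => /gh ->.
Qed.

Lemma dL_ge0 (R : realType) (g h : sym) : 0 <= dL R g h.
Proof. by rewrite /dL; case: pselect => // ex; rewrite invr_ge0 exprn_ge0. Qed.

Lemma exp2V_lt (R : realType) (e : R) : 0 < e -> exists m : nat, 2 ^- m < e.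
Proof.
move=> e0; exists (Num.bound e^-1); rewrite -[ltRHS]invrK.
rewrite ltf_pV2 ?posrE ?invr_gt0 ?exprn_gt0//.
by rewrite (lt_trans (archi_boundP _)) ?invr_ge0 ?ltW// -natrX ltr_nat ltn_expl.
Qed.

(** Neighbourhoods of 1 for the topology of pointwise convergence, in terms of
    the pointwise stabilizers of initial segments. *)
Lemma nbhs1_Aut (L : signature) (M : structure L nat) (V : set (Aut M)) :
  nbhs 1%g V ->
  exists m : nat, forall k : Aut M, (forall n, (n < m)%N -> val k n = n) -> V k.
Proof.
pose st m : set sym := [set k | forall n, (n < m)%N -> k n = n].
pose F : set_system sym := filter_from setT st.
have FF : Filter F.
  apply: filter_from_filter; first by exists 0%N.
  move=> m m' _ _; exists (maxn m m') => // k kn; split=> n nm; apply: kn.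
    by rewrite leq_max nm.
  by rewrite leq_max nm orbT.
have F1 : F --> (1%g : sym).
  apply/sym_cvgP => n; exists n.+1 => // k kn /=; exact: kn.
move=> [_ [[W Wo <-] W1 WV]].
have [m _ mW] : F W by apply: F1; apply: open_nbhs_nbhs; split.
by exists m => k km; apply: WV; exact: mW.
Qed.

Section cosets.
Variables (R : realType) (L : signature) (M : structure L nat).
Variable H : set (Aut M).

Lemma coset_dist_lt (g h : Aut M) (e : R) : H 1%g ->
  coset_dist R (lcoset_of H g) (lcoset_of H h) < e ->
  exists a b, [/\ H a, H b & dR R (val (g * a)%g) (val (h * b)%g) < e].
Proof.
move=> H1 /inf_lt[].
  exists (dR R (val (g * 1)%g) (val (h * 1)%g)).
  by exists (g * 1)%g; [exists 1%g|exists (h * 1)%g; [exists 1%g|]].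
by move=> _ [_ [a Ha <-]] [_ [b Hb <-] <-] ?; exists a, b.
Qed.

Lemma coset_dist_le (g h a b : Aut M) : H a -> H b ->
  coset_dist R (lcoset_of H g) (lcoset_of H h) <=
  dR R (val (g * a)%g) (val (h * b)%g).
Proof.
move=> Ha Hb; apply: ge_inf.
  by exists 0 => _ [? _] [? _ <-]; exact: dL_ge0.
by exists (g * a)%g; [exists a|exists (h * b)%g; [exists b|]].
Qed.

End cosets.

(** Completeness is a hypothesis on filters rather than a structure on X. *)
Lemma compact_totally_bounded (R : realType) (X : pseudoMetricType R) :
  (forall F : set_system X, ProperFilter F -> cauchy F ->
    exists x : X, F --> x) ->
  (forall e : R, 0 < e -> exists2 D : set X, finite_set D &
    forall x, exists2 y, D y & ball y e x) ->
  compact [set: X].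
Proof.
move=> Xcpl Xtb; rewrite compact_ultra => F FU _.
suff [x Fx] : exists x : X, F --> x by exists x.
apply: Xcpl; apply: cauchy_exP => e e0.
have [D /finite_fsetP[D' DE] Dcov] := Xtb e e0.
apply: contrapT => /forallNP nF.
have : F (\bigcap_(y in D) ~` ball y e).
  rewrite DE; apply: filter_bigI => y _.
  by have [/nF//|] := in_ultra_setVsetC (ball y e) FU.
move=> /filter_ex[x nx]; have [y Dy yx] := Dcov x.
exact: nx yx.
Qed.

(** * Finitely many translates up to finite precision *)

Section expansion.
Variables (L : signature) (F : structure L nat).
Variables (I : countType) (ar : I -> nat) (Rs : relations ar nat).
Local Notation Fx := (expansion F Rs).
Local Notation H := (Aut_sub F Fx).

Lemma Aut_sub_1 : H 1%g.
Proof. by have [] := Aut_sub_group_closed F Fx; rewrite inE. Qed.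

Lemma Aut_sub_V a : H a -> H a^-1%g.
Proof.
have [_ Hd] := Aut_sub_group_closed F Fx => Ha.
have := Hd 1%g a; rewrite !inE => /(_ Aut_sub_1 Ha).
by rewrite mul1g.
Qed.

(** Every automorphism of the expansion, given as a function, is an element of
    Aut F. *)
Lemma automorphism_Aut_sub (c : nat -> nat) : automorphism Fx c ->
  exists2 a : Aut F, H a & val a =1 c.
Proof.
move=> cA; have [_ [c' cK c'K]] := cA.
pose s := Sym cK c'K.
have : autset Fx s by [].
by rewrite -Aut_sub_expansion => -[a Ha as_]; exists a => // n; rewrite as_.
Qed.

Lemma Aut_embedding (g : Aut F) : embedding F F (val g).
Proof. by apply/sym_automorphism; exact: set_valP g. Qed.

Lemma subuniverse_generated (L' : signature) (T : choiceType)
    (M : structure L' T) (S : set T) : subuniverse M (generated M S).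
Proof.
by move=> f t tS U [Ucl SU]; apply: (Ucl) => i; exact: (tS i U (conj Ucl SU)).
Qed.

(** If g and h pull back the new relations to the same relations on a finite
    substructure B, then h g^-1 is an isomorphism of g(B) onto h(B) for the
    expanded structures, and extends to an automorphism of the expansion. *)
Lemma same_relations_translate (g h : Aut F) (B : set nat) :
  Fraisse Fx -> subuniverse F B -> finite_set B ->
  (forall i (t : 'I_(ar i) -> nat), (forall k, B (t k)) ->
    Rs (val g \o t) <-> Rs (val h \o t)) ->
  exists2 c : Aut F, H c & forall n, B n -> val c (val g n) = val h n.
Proof.
move=> [_ Fxu] Bcl Bfin gh.
have img (k : Aut F) : subuniverse Fx (val k @` B).
  have [ki kf kr] := Aut_embedding k.
  move=> f t tB; have tE i : {b | B b & val k b = t i}.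
    exact: cid2 (tB i).
  pose s i := s2val (tE i).
  exists (fint F s); first by apply: Bcl => i; exact: (s2valP (tE i)).
  rewrite kf; congr (fint F _); apply/funext => i /=.
  exact: (s2valP' (tE i)).
pose f : nat -> nat := val h \o val (g^-1)%g.
have fE n : f (val g n) = val h n by rewrite /f /= sfunK.
have fB x : (val g @` B) x -> (val h @` B) (f x).
  by move=> [n Bn <-]; rewrite fE; exists n.
pose f' (x : val g @` B) : val h @` B :=
  SigSub (mem_set (fB _ (set_valP x))).
pose b : nat -> nat := val g \o val (h^-1)%g.
have bB x : (val h @` B) x -> (val g @` B) (b x).
  by move=> [n Bn <-]; rewrite /b /= sfunK; exists n.
pose b' (x : val h @` B) : val g @` B :=
  SigSub (mem_set (bB _ (set_valP x))).
have fF : embedding F F f.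
  exact: comp_embedding (Aut_embedding g^-1%g) (Aut_embedding h).
have f'iso : isomorphism (substructure (img g)) (substructure (img h)) f'.
  split; last first.
    by exists b' => x; apply: val_inj; rewrite /= /f /b /= ?sinvK ?sfunK ?sinvK.
  have [fi ff fr] := fF; split.
  - by move=> x y xy; apply: val_inj; apply: fi; exact: (congr1 val xy).
  - by move=> s t; apply: val_inj; rewrite /= ff.
  case=> [r|i] t; first exact: fr.
  have tE k : {n | B n & val g n = val (t k)} 
    by exact: cid2 (set_valP (t k)).
  pose s k := s2val (tE k).
  have sB k : B (s k) by exact: (s2valP (tE k)).
  have gs : val g \o s = (fun k => val (t k)).
    by apply/funext => k /=; exact: (s2valP' (tE k)).
  have hs : val h \o s = (fun k => val (f' (t k))).
    by apply/funext => k /=; rewrite -(s2valP' (tE k)) fE.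
  by have := gh i s sB; rewrite gs hs.
have [c cA cE] := Fxu _ _ (img g) (img h) (finite_image _ Bfin)
  (finite_image _ Bfin) f' f'iso.
have [a Ha aE] := automorphism_Aut_sub cA.
exists a => // n Bn; have gB : (val g @` B) (val g n) by exists n.
by rewrite aE (cE (SigSub (mem_set gB))) /= fE.
Qed.

(** The new relations, pulled back to B along the restriction of g. Since B is
    a finite set of type fset, its elements form a finite type. *)
Definition pullback (B : {fset nat}) (g : Aut F) : relations ar B :=
  fun i t => Rs (fun k => val g (val (t k))).

Arguments pullback : clear implicits.

(** When B is a substructure, [pullback B g] is an expansion of it in the age of
    the expanded structure, as witnessed by the restriction of g. *)
Lemma finite_pullback (B : {fset nat}) : precompact_expansion F Rs ->
  subuniverse F [set` B] -> finite_set (range (pullback B)).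
Proof.
move=> Fp Bcl.
pose N : structure L B := Structure
  (fun f (t : 'I_(far f) -> B) =>
    [` Bcl f (val \o t) (fun k => valP (t k))]%fset)
  (fun r (t : 'I_(rar r) -> B) => rint F (val \o t)).
have vN : embedding N F val by split => //; exact: val_inj.
have Nage : age F N by exists val.
apply: sub_finite_set (Fp B N Nage) => _ [g _ <-].
exists (val g \o val).
have [gi gf gr] := comp_embedding vN (Aut_embedding g).
by split => //; case.
Qed.

Lemma finite_translates (m : nat) : Fraisse F -> Fraisse Fx ->
  precompact_expansion F Rs ->
  exists2 D : set (Aut F), finite_set D &
    forall g, exists2 d, D d & exists2 c, H c &
      forall n, (n < m)%N -> val (c * g)%g n = val d n.
Proof.
move=> [Flf _] Fxf Fp.
pose A := generated F `I_m.
have /finite_fsetP[B AB] : finite_set A by apply: Flf; exact: finite_II.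
have Bcl : subuniverse F [set` B] by rewrite -AB; exact: subuniverse_generated.
(* f chooses one automorphism for each realized pullback on B. *)
pose f S := xget 1%g [set g | pullback B g = S].
exists (f @` range (pullback B)); first exact/finite_image/finite_pullback.
move=> g; exists (f (pullback B g)); first by exists (pullback B g).
have fg : pullback B (f (pullback B g)) = pullback B g.
  by rewrite /f; case: xgetP => [y _ //|/(_ g) []].
have [|c Hc cE] := @same_relations_translate g (f (pullback B g)) _ Fxf Bcl
  (finite_fset B).
  move=> i t tB.
  pose s k : B := [` tB k]%fset.
  suff : pullback B g i s <-> pullback B (f (pullback B g)) i s by [].
  by rewrite fg.
exists c => // n nm; apply: cE; rewrite -AB.
by move=> U [_ IU]; exact: IU.
Qed.

End expansion.

(** * The completion of the coset space *)

Section completion.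
Variables (R : realType) (L : signature) (F : structure L nat).
Variables (I : countType) (ar : I -> nat) (Rs : relations ar nat).
Local Notation H := (Aut_sub F (expansion F Rs)).
Variables (X : metricType R) (j : lcoset_space H -> X).

Lemma lcoset_of_mulr (g a : Aut F) : H a ->
  lcoset_of H (g * a)%g = lcoset_of H g.
Proof.
have [_ Hd] := Aut_sub_group_closed F (expansion F Rs) => Ha.
have HV b c : H b -> H c -> H (b / c)%g.
  by have := Hd b c; rewrite !inE; apply.
apply: val_inj; apply/seteqP; split=> _ [h Hh <-].
  exists (a * h)%g; last by rewrite mulgA.
  by rewrite -[h]invgK; apply: HV => //; exact: Aut_sub_V.
exists (a^-1 * h)%g; last by rewrite mulgA mulgK.
rewrite -[h]invgK; apply: HV; exact: Aut_sub_V.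
Qed.

Lemma completion_dense : is_completion (@coset_dist R L F H) j ->
  dense (range (fun g => j (lcoset_of H g))).
Proof.
move=> [_ _ jd] O O0 Oo; have [x [Ox [q _ qx]]] := jd O O0 Oo.
exists x; split=> //; have [g _ gq] := set_valP q.
by exists g => //; rewrite -qx; congr j; exact: val_inj.
Qed.

Lemma completion_compact : Fraisse F -> Fraisse (expansion F Rs) ->
  precompact_expansion F Rs -> is_completion (@coset_dist R L F H) j ->
  compact [set: X].
Proof.
move=> Ff Fxf Fp jc; have [Xcpl jd _] := jc.
apply: compact_totally_bounded => // e e0.
have [m me] : exists m : nat, 2 ^- m < e / 2.
  by apply: exp2V_lt; rewrite divr_gt0.
have [D Dfin Dcov] := finite_translates m Ff Fxf Fp.
(* The distance dR compares inverses, so the translates are taken for g^-1: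
   c g^-1 = d on 0, ..., m-1 puts g c^-1, which is in g H, close to d^-1. *)
exists ((fun d => j (lcoset_of H d^-1%g)) @` D); first exact: finite_image.
move=> x; have e2 : 0 < e / 2 by rewrite divr_gt0.
have xn : (ball x (e / 2))° x by apply: nbhs_singleton; apply: nbhs_interior;
  exact: nbhsx_ballx.
have [y [xy [g _ gE]]] := completion_dense jc (ex_intro _ x xn)
  (@open_interior _ _).
have [d Dd [c Hc cE]] := Dcov g^-1%g.
exists (j (lcoset_of H d^-1%g)); first by exists d.
rewrite [e]splitr; apply: (@ball_triangle _ _ y); last first.
  by apply: ball_sym; exact: interior_subset xy.
rewrite -gE ballEmdist /= jd; apply: le_lt_trans me.
have := @coset_dist_le R _ _ H d^-1%g g 1%g c^-1%g (Aut_sub_1 _ _)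
  (Aut_sub_V Hc).
move=> /le_trans; apply; apply: dL_le => n nm.
have -> : ((val (d^-1 * 1)%g)^-1)%g = val d :> sym.
  by rewrite mulg1 -[LHS]/(val (d^-1)^-1%g) invgK.
have -> : ((val (g * c^-1)%g)^-1)%g = val (c * g^-1)%g :> sym.
  by rewrite -[LHS]/(val (g * c^-1)^-1%g) invgM invgK.
by rewrite cE.
Qed.

Lemma completion_unif (Y : topologicalType) (actY : Aut F -> Y -> Y) (y0 : Y) :
  is_completion (@coset_dist R L F H) j ->
  is_flow actY -> (forall h, H h -> actY h y0 = y0) ->
  forall V : set (Aut F), nbhs 1%g V ->
  exists2 e : R, 0 < e & forall g h,
    ball (j (lcoset_of H g)) e (j (lcoset_of H h)) ->
    exists2 k, V k & actY h y0 = actY k (actY g y0).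
Proof.
move=> [_ jd _] actYF fixed V /nbhs1_Aut[m mV].
exists (2 ^- m); first by rewrite invr_gt0 exprn_gt0.
move=> g h; rewrite ballEmdist /= jd => /(coset_dist_lt (Aut_sub_1 _ _)).
move=> [a [b [Ha Hb ab]]].
(* Closeness of the representatives g a and h b for dR means that their inverses
   agree on 0, ..., m, so that (h b) (g a)^-1 fixes these points. *)
exists ((h * b) * (g * a)^-1)%g.
  apply: mV => n nm; have ga_hb := dL_lt ab (ltnW nm).
  rewrite -[LHS]/(Defs.sfun (val (h * b)%g)
    (Defs.sfun ((val (g * a)%g)^-1)%g n)) ga_hb.
  exact: sinvK.
rewrite -(flowM actYF) -{1}(fixed b Hb) -{2}(fixed a Ha) -!(flowM actYF).
by rewrite -!mulgA mulVg mulg1.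
Qed.

End completion.

(** * Universality and relative extreme amenability *)

Theorem theorem1 (R : realType) (L : signature) (F : structure L nat)
    (I : countType) (ar : I -> nat) (Rs : relations ar nat)
    (X : metricType R)
    (j : lcoset_space (Aut_sub F (expansion F Rs)) -> X)
    (act : Aut F -> X -> X) :
  Fraisse F -> Fraisse (expansion F Rs) -> precompact_expansion F Rs ->
  is_completion_flow j act ->
  universal_flow act <->
  relatively_extremely_amenable (Aut_sub F (expansion F Rs)).
Proof.
move=> Ff Fxf Fp [jc actF actj]; split=> [univ Z actZ actZF Zco|rea Y actY].
  have [A [Ainv [A0 Aco Amin]]] := exists_minimal_subflow actZF Zco.
  have [p [_ _ peq]] := univ _ _ (is_flow_subflow Ainv actZF A0)
    (compact_set_type Aco) Amin.
  exists (val (p (j (lcoset_of (Aut_sub F (expansion F Rs)) 1%g)))) => h Hh.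
  (* h fixes the base point because h H = H. *)
  rewrite -[LHS]/(val (subflow Ainv h _)) -peq actj mulg1.
  by rewrite -[in LHS](mul1g h) lcoset_of_mulr.
move=> actYF Yco Ymin; have [y0 y0H] := rea _ _ actYF Yco.
have [p [pc pphi peq]] := orbit_map_extension (completion_dense jc) actYF Yco
  (completion_unif jc actYF y0H) (fun g => flow_act_continuous actF) actj.
exists p; split=> //.
suff pT : closed (range p).
  move=> y; have [x _ <-] : range p y; last by exists x.
  apply: contrapT => npy.
  have [z [nz [g _ zE]]] := Ymin y0 (~` range p) (ex_intro _ y npy)
    (closed_openC pT).
  by apply: nz; rewrite -zE -pphi; exists (j (lcoset_of _ g)).
apply: compact_closed; first exact: flow_hausdorff actYF.
apply: continuous_compact; last exact: completion_compact jc.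
exact: continuous_subspaceT.
Qed.
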